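(* Let $M_1$ and $M_2$ be two $\Gamma$-semigroups, let $T: M_1 \to \mathcal{P}^*(M_2)$ be a set-valued anti-homomorphism, and let $B$ be a left bi-quasi ideal of $M_2$. Then: (i) $\overline{T}(B)$ is a left bi-quasi ideal of $M_1$, if $T(x)\neq\emptyset$ for all $x\in M_1$ and $\overline{T}(B)\neq\emptyset$; (ii) $\underline{T}(B)$ is a left bi-quasi ideal of $M_1$, if $\underline{T}(B)\neq\emptyset$ and $T$ is a strong set-valued anti-homomorphism.
   Context: For non-empty sets $M$ and $\Gamma$, $M$ is a $\Gamma$-semigroup if there is a map $M\times\Gamma\times M\to M$, $(a,\alpha,b)\mapsto a\alpha b$, with $(a\alpha b)\beta c = a\alpha(b\beta c)$ for all $a,b,c\in M$, $\alpha,\beta\in\Gamma$. Both $M_1$ and $M_2$ are $\Gamma$-semigroups for the same set $\Gamma$. For subsets $A,B$ of a $\Gamma$-semigroup and $\alpha\in\Gamma$, $A\alpha B=\{a\alpha b : a\in A, b\in B\}$ and $A\Gamma B=\{a\gamma b : a\in A, b\in B,\gamma\in\Gamma\}$. $\mathcal{P}^*(M_2)$ is the set of all non-empty subsets of $M_2$. A map $T:M_1\to\mathcal{P}^*(M_2)$ is a set-valued anti-homomorphism if $T(a\alpha b)\supseteq T(b)\alpha T(a)$ for all $a,b\in M_1$, $\alpha\in\Gamma$; it is a strong set-valued anti-homomorphism if $T(a\alpha b)=T(b)\alpha T(a)$ for all $a,b\in M_1$, $\alpha\in\Gamma$. For $G\subseteq M_2$, $\underline{T}(G)=\{x\in M_1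 : T(x)\subseteq G\}$ and $\overline{T}(G)=\{x\in M_1 : T(x)\cap G\neq\emptyset\}$. A non-empty subset $S$ of a $\Gamma$-semigroup $M$ is a sub-$\Gamma$-semigroup of $M$ if $S\Gamma S\subseteq S$. A non-empty subset $B$ of $M$ is a left bi-quasi ideal of $M$ if $B$ is a sub-$\Gamma$-semigroup of $M$ and $(M\Gamma B)\cap(B\Gamma M\Gamma B)\subseteq B$. *)

(* Defs.v *)
From mathcomp Require Import all_boot.
From mathcomp Require Import boolp classical_sets.

Set Implicit Arguments.
Unset Strict Implicit.
Unset Printing Implicit Defensive.

Local Open Scope classical_set_scope.

Record gammaSemigroup (Gamma : Type) := GammaSemigroup {
  gsort :> Type;
  gmul : gsort -> Gamma -> gsort -> gsort;
  gsort_inhabited : inhabited gsort;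
  gamma_inhabited : inhabited Gamma;
  gmulA : forall (a b c : gsort) (alpha beta : Gamma),
    gmul (gmul a alpha b) beta c = gmul a alpha (gmul b beta c)
}.

Record powerset_ne (T : Type) := PowersetNE {
  pne_set :> set T;
  pne_neq0 : pne_set !=set0
}.

Section GammaSets.
Variables (Gamma : Type) (M : gammaSemigroup Gamma).
Implicit Types A B S : set M.

Definition set_gmul A (alpha : Gamma) B : set M :=
  [set gmul a alpha b | a in A & b in B].

Definition set_Gmul A B : set M :=
  [set x | exists (a : M) (gamma : Gamma) (b : M),
     [/\ A a, B b & x = gmul a gamma b]].

Definition sub_gamma_semigroup S : Prop :=
  S !=set0 /\ set_Gmul S S `<=` S.

(* B Gamma M Gamma B is bracketed as (B Gamma M) Gamma B; the two bracketings agree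
   by gmulA. *)
Definition left_bi_quasi_ideal B : Prop :=
  [/\ B !=set0, sub_gamma_semigroup B &
      set_Gmul setT B `&` set_Gmul (set_Gmul B setT) B `<=` B].

End GammaSets.

Section SetValuedMaps.
Variables (Gamma : Type) (M1 M2 : gammaSemigroup Gamma).
Variable T : M1 -> powerset_ne M2.

Definition set_valued_antihom : Prop :=
  forall (a b : M1) (alpha : Gamma),
    set_gmul (T b) alpha (T a) `<=` T (gmul a alpha b).

Definition strong_set_valued_antihom : Prop :=
  forall (a b : M1) (alpha : Gamma),
    T (gmul a alpha b) = set_gmul (T b) alpha (T a) :> set M2.

Definition lower_approx (G : set M2) : set M1 := [set x | T x `<=` G].

Definition upper_approx (G : set M2) : set M1 := [set x | T x `&` G !=set0].

End SetValuedMaps.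

(* Main.v *)
(** Since [B Gamma M Gamma B] is contained in [M Gamma B], a left bi-quasi ideal is
    the same as a sub-Gamma-semigroup with [B Gamma M Gamma B] contained in [B]. This
    condition is symmetric under reversing products, so the reversal caused by an
    anti-homomorphism is harmless. *)
Require Import Defs.
From mathcomp Require Import all_boot.
From mathcomp Require Import boolp classical_sets.

Set Implicit Arguments.
Unset Strict Implicit.
Unset Printing Implicit Defensive.

Local Open Scope classical_set_scope.

Lemma left_bi_quasi_idealP (Gamma : Type) (M : gammaSemigroup Gamma) (B : set M) :
  left_bi_quasi_ideal B <->
  [/\ B !=set0,
      (forall (a b : M) (alpha : Gamma), B a -> B b -> B (gmul a alpha b)) &
      (forall (a m b : M) (alpha beta : Gamma),
         B a -> B b -> B (gmul (gmul a alpha m) beta b))].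
Proof.
split=> [[B0 [_ BB] BMB]|[B0 BB BMB]]; split=> //.
- by move=> a b alpha Ba Bb; apply: BB; exists a, alpha, b.
- move=> a m b alpha beta Ba Bb; apply: BMB; split.
    (* One factorization, with left factor [gmul a alpha m], serves both sides of the
       intersection. *)
    by exists (gmul a alpha m), beta, b.
  by exists (gmul a alpha m), beta, b; split=> //; exists a, alpha, m.
- by split=> // _ [a [alpha [b [Ba Bb ->]]]]; apply: BB.
- by move=> _ [_ [_ [beta [b [[a [alpha [m [Ba _ ->]]]] Bb ->]]]]]; apply: BMB.
Qed.

Section Approximations.
Variables (Gamma : Type) (M1 M2 : gammaSemigroup Gamma).
Variables (T : M1 -> powerset_ne M2) (B : set M2).

(** One common point of [B] and the image of a product is enough, so the inclusion suffices:
    multiply chosen points of the images in reverse order. *)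
Lemma upper_approx_left_bi_quasi_ideal :
  left_bi_quasi_ideal B -> set_valued_antihom T -> upper_approx T B !=set0 ->
  left_bi_quasi_ideal (upper_approx T B).
Proof.
move=> /left_bi_quasi_idealP[_ BB BMB] antiT T0; apply/left_bi_quasi_idealP; split=> //.
- move=> a b alpha [a' [Ta Ba]] [b' [Tb Bb]]; exists (gmul b' alpha a').
  by split; [apply: (antiT); exists b' => //; exists a' | apply: BB].
- move=> a m b alpha beta [a' [Ta Ba]] [b' [Tb Bb]].
  (* [m] is arbitrary, so [T m] may miss [B]; any point of it can be the middle factor. *)
  have [m' Tm] := pne_neq0 (T m).
  exists (gmul b' beta (gmul m' alpha a')); split.
    apply: (antiT); exists b' => //; exists (gmul m' alpha a') => //.
    by apply: (antiT); exists m' => //; exists a'.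
  by rewrite -gmulA; apply: BMB.
Qed.

(** Here every point of the image of a product must lie in [B]. Equality in the strong condition
    lets each such point be factored through the images of the factors. *)
Lemma lower_approx_left_bi_quasi_ideal :
  left_bi_quasi_ideal B -> strong_set_valued_antihom T -> lower_approx T B !=set0 ->
  left_bi_quasi_ideal (lower_approx T B).
Proof.
move=> /left_bi_quasi_idealP[_ BB BMB] antiT T0; apply/left_bi_quasi_idealP; split=> //.
- move=> a b alpha TaB TbB y; rewrite antiT => -[b' Tb [a' Ta <-]].
  by apply: BB; [apply: TbB | apply: TaB].
- move=> a m b alpha beta TaB TbB y; rewrite antiT => -[b' Tb [c]].
  (* The second factoring gives [y] as b' beta (m' alpha a'); reassociating puts the points of [B]
     at the two ends. *)
  rewrite antiT => -[m' _ [a' Ta <-]] <-; rewrite -gmulA.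
  by apply: BMB; [apply: TbB | apply: TaB].
Qed.

End Approximations.

Theorem theorem5p8 (Gamma : Type) (M1 M2 : gammaSemigroup Gamma)
    (T : M1 -> powerset_ne M2) (B : set M2) :
  set_valued_antihom T ->
  left_bi_quasi_ideal B ->
  ((forall x : M1, T x !=set0) ->
   upper_approx T B !=set0 ->
   left_bi_quasi_ideal (upper_approx T B)) /\
  (lower_approx T B !=set0 ->
   strong_set_valued_antihom T ->
   left_bi_quasi_ideal (lower_approx T B)).
Proof.
move=> antiT idealB; split=> [_ | T0 strongT].
  exact: upper_approx_left_bi_quasi_ideal.
exact: lower_approx_left_bi_quasi_ideal.
Qed.
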